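(* Let $D$ be an infinite division ring and $n\ge 2$. Then the graph $\Delta(\mathrm{GL}_n(D))$ is complete. Moreover, the vertex set of $\Delta(\mathrm{GL}_n(D))$ consists of all non-central normal proper subgroups of $\mathrm{GL}_n(D)$. Also, a proper subgroup $N$ of $\mathrm{GL}_n(D)$ is a vertex of $\Delta(\mathrm{GL}_n(D))$ if and only if $N$ contains $\mathrm{SL}_n(D)$.
   Context: $\mathrm{GL}_n(D)$ is the general linear group of degree $n$ over $D$ and $\mathrm{SL}_n(D)$ is the special linear group (the subgroup generated by the elementary transvections, equivalently the kernel of the Dieudonné determinant). A subgroup $N$ of a group $G$ is almost subnormal in $G$ if there is a finite chain of subgroups $N=N_r\le N_{r-1}\le\dots\le N_1\le N_0=G$ such that for every $0\le i<r$, either $N_{i+1}$ is normal in $N_i$ or the index $[N_i:N_{i+1}]$ is finite. The intersection graph $\Gamma(G)$ of a group $G$ has as vertices all non-trivial proper subgroups of $G$; two distinct vertices $A,B$ are adjacent if $A\cap B\neq 1$. $\Delta(\mathrm{GL}_n(D))$ is the induced subgraph of $\Gamma(\mathrm{GL}_n(D))$ whose vertices are all proper subgroups of $\mathrm{GL}_n(D)$ that are non-central (not contained in the center of $\mathrm{GL}_n(D)$) and almost subnormal in $\mathrm{GL}_n(D)$. A graph is complete if any two distinct vertices are adjacent. *)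

(* Defs.v *)
From HB Require Import structures.
From mathcomp Require Import all_boot all_order all_algebra.
From mathcomp Require Import all_classical.

Set Implicit Arguments.
Unset Strict Implicit.
Unset Printing Implicit Defensive.

Import GRing.Theory.

Local Open Scope classical_set_scope.
Local Open Scope group_scope.

(* Subsets of a (possibly infinite) group are classical sets; [group_closed] is
   the library's subgroup condition, [in H] turning H into a predicate. *)
Definition is_subgroup (G : groupType) (H : set G) : Prop :=
  group_closed [in H].

Definition is_normal_in (G : groupType) (K H : set G) : Prop :=
  K `<=` H /\ forall h k, H h -> K k -> K (k ^ h).

(* The quantity [H : K] is the number of left cosets h K with h in H. *)
Definition finite_index_in (G : groupType) (K H : set G) : Prop :=
  finite_set [set [set h * k | k in K] | h in H].

Definition almost_subnormal (G : groupType) (N : set G) : Prop :=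
  exists (r : nat) (C : nat -> set G),
    [/\ C 0%N = [set: G], C r = N,
        forall i, (i <= r)%N -> is_subgroup (C i) &
        forall i, (i < r)%N -> C i.+1 `<=` C i /\
          (is_normal_in (C i.+1) (C i) \/ finite_index_in (C i.+1) (C i))].

Definition group_center (G : groupType) : set G :=
  [set z | forall x, commute z x].

Arguments group_center : clear implicits.

Definition subgroup_generated (G : groupType) (S : set G) : set G :=
  [set x | forall H : set G, is_subgroup H -> S `<=` H -> H x].

Record simple_graph (V : Type) := SimpleGraph {
  vertices : set V;
  adjacent : V -> V -> Prop;
  adjacent_vertices : forall x y, adjacent x y -> vertices x /\ vertices y;
  adjacent_sym : forall x y, adjacent x y -> adjacent y x;
  adjacent_irrefl : forall x, ~ adjacent x x }.

Definition complete_graph (V : Type) (g : simple_graph V) : Prop :=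
  forall x y, vertices g x -> vertices g y -> x <> y -> adjacent g x y.

Section InducedSubgraph.
Context (V : Type) (g : simple_graph V) (S : set V).

Let W : set V := vertices g `&` S.
Let adj (x y : V) : Prop := [/\ adjacent g x y, S x & S y].

Fact induced_vertices x y : adj x y -> W x /\ W y.
Proof. by move=> [xy Sx Sy]; have [] := adjacent_vertices xy. Qed.

Fact induced_sym x y : adj x y -> adj y x.
Proof. by move=> [xy Sx Sy]; split=> //; apply: adjacent_sym. Qed.

Fact induced_irrefl x : ~ adj x x.
Proof. by move=> [xx _ _]; apply: adjacent_irrefl xx. Qed.

Definition induced_subgraph : simple_graph V :=
  SimpleGraph induced_vertices induced_sym induced_irrefl.

End InducedSubgraph.

Section IntersectionGraph.
Context (G : groupType).

Let proper_nontrivial : set (set G) :=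
  [set A | [/\ is_subgroup A, A <> [set 1] & A <> [set: G]]].
Let meet (A B : set G) : Prop :=
  [/\ proper_nontrivial A, proper_nontrivial B, A <> B & A `&` B <> [set 1]].

Fact meet_vertices A B :
  meet A B -> proper_nontrivial A /\ proper_nontrivial B.
Proof. by case. Qed.

Fact meet_sym A B : meet A B -> meet B A.
Proof. by move=> [? ? /nesym ?]; rewrite setIC. Qed.

Fact meet_irrefl A : ~ meet A A.
Proof. by case. Qed.

Definition intersection_graph : simple_graph (set G) :=
  SimpleGraph meet_vertices meet_sym meet_irrefl.

End IntersectionGraph.

Definition Delta_graph (G : groupType) : simple_graph (set G) :=
  induced_subgraph (intersection_graph G)
    [set N | ~ (N `<=` group_center G) /\ almost_subnormal N].

Section GeneralLinearGroup.
Context (D : nzRingType) (n : nat).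

(* The ring D need not be commutative, so that the library's [unitmx], [invmx]
   and 'GL_n do not apply. An invertible matrix is stored together with its
   (unique) two-sided inverse; the projection [GLmx] to matrices is injective. *)
Record GL := MkGL {
  GLpair : 'M[D]_n * 'M[D]_n;
  GLpairP : ((GLpair.1 *m GLpair.2 == 1%:M) && (GLpair.2 *m GLpair.1 == 1%:M))%R
}.

HB.instance Definition _ := [isSub for GLpair].
HB.instance Definition _ := [Choice of GL by <:].

Definition GLmx (g : GL) : 'M[D]_n := (GLpair g).1.

Lemma GLmx_inj : injective GLmx.
Proof.
move=> [[A A'] /= hA] [[B B'] /= hB]; rewrite /GLmx /= => eAB; subst B.
apply: val_inj => /=; congr pair.
have [/andP[_ /eqP hA'] /andP[/eqP hB' _]] := (hA, hB).
by rewrite -[A']mulmx1 -hB' mulmxA hA' mul1mx.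
Qed.

Lemma GL_exists (A B : 'M[D]_n) :
  (A *m B = 1%:M)%R -> (B *m A = 1%:M)%R -> exists g : GL, GLmx g = A.
Proof.
move=> AB BA; have P : (A *m B == 1%:M)%R && (B *m A == 1%:M)%R.
  by rewrite AB BA !eqxx.
by exists (@MkGL (A, B) P).
Qed.

Fact GL_one_subproof :
  ((1%:M : 'M[D]_n) *m 1%:M == 1%:M)%R && ((1%:M : 'M[D]_n) *m 1%:M == 1%:M)%R.
Proof. by rewrite mulmx1 eqxx. Qed.
Definition GL_one : GL := @MkGL (1%:M%R, 1%:M%R) GL_one_subproof.

Fact GL_inv_subproof (g : GL) :
  ((GLpair g).2 *m (GLpair g).1 == 1%:M)%R &&
  ((GLpair g).1 *m (GLpair g).2 == 1%:M)%R.
Proof. by rewrite andbC GLpairP. Qed.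
Definition GL_inv (g : GL) : GL :=
  @MkGL ((GLpair g).2, (GLpair g).1) (GL_inv_subproof g).

Fact GL_mul_subproof (g h : GL) :
  (((GLpair g).1 *m (GLpair h).1) *m ((GLpair h).2 *m (GLpair g).2)
     == 1%:M)%R &&
  (((GLpair h).2 *m (GLpair g).2) *m ((GLpair g).1 *m (GLpair h).1)
     == 1%:M)%R.
Proof.
have /andP[/eqP g12 /eqP g21] := GLpairP g.
have /andP[/eqP h12 /eqP h21] := GLpairP h.
rewrite mulmxA -(mulmxA (GLpair g).1) h12 mulmx1 g12 eqxx /=.
by rewrite mulmxA -(mulmxA (GLpair h).2) g21 mulmx1 h21.
Qed.
Definition GL_mul (g h : GL) : GL :=
  @MkGL ((GLpair g).1 *m (GLpair h).1, (GLpair h).2 *m (GLpair g).2)%R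
    (GL_mul_subproof g h).

Fact GL_mulA : associative GL_mul.
Proof. by move=> x y z; apply: GLmx_inj; rewrite /GLmx /= mulmxA. Qed.
Fact GL_mul1 : left_id GL_one GL_mul.
Proof. by move=> x; apply: GLmx_inj; rewrite /GLmx /= mul1mx. Qed.
Fact GL_mulr1 : right_id GL_one GL_mul.
Proof. by move=> x; apply: GLmx_inj; rewrite /GLmx /= mulmx1. Qed.
Fact GL_mulV : left_inverse GL_one GL_inv GL_mul.
Proof.
move=> x; apply: GLmx_inj; rewrite /GLmx /=.
by have /andP[_ /eqP] := GLpairP x.
Qed.
Fact GL_mulrV : right_inverse GL_one GL_inv GL_mul.
Proof.
move=> x; apply: GLmx_inj; rewrite /GLmx /=.
by have /andP[/eqP] := GLpairP x.
Qed.

HB.instance Definition _ :=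
  isGroup.Build GL GL_mulA GL_mul1 GL_mulr1 GL_mulV GL_mulrV.

Definition transvections : set GL :=
  [set g | exists (i j : 'I_n) (a : D),
     i != j /\ GLmx g = (1%:M + a *: delta_mx i j)%R].

Definition SL : set GL := subgroup_generated transvections.

End GeneralLinearGroup.
Arguments GL : clear implicits.
Arguments transvections : clear implicits.
Arguments SL : clear implicits.

(* Main.v *)
Require Import Defs.
From HB Require Import structures.
From mathcomp Require Import all_boot all_order all_algebra.
From mathcomp Require Import finmap all_classical.

(** The heart of the matter is that, for an infinite division ring [D] and
    [n >= 2], every almost subnormal subgroup of [GL D n] which is not central
    contains [SL D n] ([almost_subnormal_SL]). Conversely [SL D n] contains all
    commutators of [GL D n] ([commutator_SL]), so that every subgroup
    containing it is normal, hence almost subnormal. The vertices of the graph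
    are therefore the proper subgroups containing [SL D n], which are also the
    non-central normal proper subgroups, and any two of them meet in a
    non-trivial group because [SL D n] is not trivial.

    The containment is proved by going down the chain of subgroups
    [GL D n = C 0, ..., C r = N], all of which are non-central. Suppose that
    [C i] contains [SL D n].

    If [C i.+1] is normal in [C i], then it is normalised by [SL D n], and the
    simplicity argument of Iwasawa applies ([SL_sub_normalised]). Let [K] be a
    non-central subgroup normalised by [SL D n]. Then [K] contains a matrix
    that is not diagonal ([exists_off_diagonal]), that is, one which moves some
    coordinate line; its conjugates under [SL D n] send that line to all the
    other coordinate lines ([moves_to_all_lines]). Let [U] be the abelian group
    of the matrices [1 + M] such that [M] takes its values in the chosen line
    and vanishes on it. Every elementary transvection is conjugate
    to an element of [U] under [K], so that [SL D n] is contained in [K U] and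
    the commutators of [SL D n] are in [K] ([commutator_in_complement]). Each
    elementary transvection is such a commutator as soon as [D] has more than
    three elements ([transvection_commutator]).

    If [C i.+1] has finite index in [C i], then two distinct transvections
    among the infinitely many [1 + a E_ij] permute the cosets of [C i.+1] in
    the same way ([finite_index_pigeonhole]). Their quotient is a non-trivial
    transvection lying in the largest subgroup of [C i.+1] normalised by
    [C i], and the first case applies to that subgroup
    ([finite_index_SL]). *)

Set Implicit Arguments.
Unset Strict Implicit.
Unset Printing Implicit Defensive.

Import GRing.Theory.

Local Open Scope classical_set_scope.
Local Open Scope group_scope.

(** * Subgroups of a group *)

Section Subgroups.
Variable G : groupType.
Implicit Types (H K U S : set G) (g h x y : G).

Lemma subgroupP H :
  is_subgroup H <-> H 1 /\ forall x y, H x -> H y -> H (x / y).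
Proof.
split=> [[H1 Hd]|[H1 Hd]]; split.
- exact: set_mem.
- by move=> x y Hx Hy; apply/set_mem/Hd; apply: mem_set.
- exact: mem_set.
- by move=> x y Hx Hy; apply/mem_set/Hd; apply: set_mem.
Qed.

Lemma subgroup1 H : is_subgroup H -> H 1.
Proof. by move=> /subgroupP[]. Qed.

Lemma subgroupV H x : is_subgroup H -> H x -> H x^-1.
Proof. by move=> /subgroupP[H1 Hd] Hx; rewrite -div1g; apply: Hd. Qed.

Lemma subgroupM H x y : is_subgroup H -> H x -> H y -> H (x * y).
Proof.
move=> sH Hx Hy; have /subgroupP[_ Hd] := sH.
by rewrite -[y]invgK; apply: Hd => //; apply: subgroupV.
Qed.

Lemma subgroupJ H x y : is_subgroup H -> H x -> H y -> H (x ^ y).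
Proof.
by move=> sH Hx Hy; rewrite conjgE; do 2?apply: subgroupM => //;
  apply: subgroupV.
Qed.

Lemma subgroup_gen S : is_subgroup (subgroup_generated S).
Proof.
apply/subgroupP; split=> [H sH _|x y Sx Sy H sH SH]; first exact: subgroup1.
by have /subgroupP[_] := sH; apply; [apply: Sx | apply: Sy].
Qed.

Lemma sub_gen S : S `<=` subgroup_generated S.
Proof. by move=> x Sx H _; apply. Qed.

Lemma gen_sub S H : is_subgroup H -> S `<=` H -> subgroup_generated S `<=` H.
Proof. by move=> sH SH x; apply. Qed.

(** The equivalence, rather than an implication, is what makes the normaliser
    of an infinite subset closed under inverses. *)
Definition normaliser H : set G := [set g | forall h, H (h ^ g) <-> H h].

Lemma subgroup_normaliser H : is_subgroup (normaliser H).
Proof.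
apply/subgroupP; split=> [h|x y Nx Ny h]; first by rewrite conjg1.
rewrite conjgM; have := Ny ((h ^ x) ^ y^-1); rewrite conjgKV => <-.
exact: Nx.
Qed.

Lemma normaliser_sub H : is_subgroup H -> H `<=` normaliser H.
Proof.
move=> sH g Hg h; split=> [Hhg|Hh]; last exact: subgroupJ.
by rewrite -(conjgK g h); apply: subgroupJ => //; apply: subgroupV.
Qed.

Lemma normal_normaliser K H : is_subgroup H -> is_normal_in K H ->
  H `<=` normaliser K.
Proof.
move=> sH [_ KH] g Hg h; split=> [Khg|]; last exact: KH.
by rewrite -(conjgK g h); apply: KH => //; apply: subgroupV.
Qed.

Lemma normaliser_gen S g :
    (forall s, S s -> subgroup_generated S (s ^ g)) ->
    (forall s, S s -> subgroup_generated S (s ^ g^-1)) ->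
  normaliser (subgroup_generated S) g.
Proof.
have conj_gen z : (forall s, S s -> subgroup_generated S (s ^ z)) ->
    forall h, subgroup_generated S h -> subgroup_generated S (h ^ z).
  move=> Sz; apply: (@gen_sub S [set h | subgroup_generated S (h ^ z)]) => //.
  apply/subgroupP; split=> [|x y /= Sx Sy]; rewrite /= ?conj1g.
    by apply: subgroup1; apply: subgroup_gen.
  by rewrite conjMg conjVg; have /subgroupP[_] := subgroup_gen S; apply.
move=> Sg SgV h; split; last exact: conj_gen.
by move/(conj_gen _ SgV); rewrite conjgK.
Qed.

(** The elements commuting with [y] modulo a normal subgroup [H] form a
    subgroup. *)
Lemma subgroup_commutes_mod H y : is_subgroup H ->
    (forall g, normaliser H g) ->
  is_subgroup [set x | H [~ x, y]].
Proof.
move=> sH nH.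
have cM x z : H [~ x, y] -> H [~ z, y] -> H [~ x * z, y].
  move=> Hx Hz; have -> : [~ x * z, y] = [~ x, y] ^ z * [~ z, y].
    by rewrite !commgEr conjMg !conjgE !invgM !mulgA !mulgK.
  by apply: subgroupM => //; apply/nH.
apply/subgroupP; split=> [|x z /= Hx Hz]; first by rewrite /= comm1g;
  apply: subgroup1.
apply: cM => //; apply/(nH z).
have -> : [~ z^-1, y] ^ z = [~ z, y]^-1.
  by rewrite !commgEl !conjgE !invgM !invgK !mulgA mulVg mul1g.
exact: subgroupV.
Qed.

(** If [K] is normalised by an abelian group [U], then [K U / K] is abelian, so
    that a group generated by elements of [K U] has its commutators in [K]. *)
Lemma commutator_in_complement K U S :
    is_subgroup K -> is_subgroup U -> U `<=` normaliser K ->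
    (forall u v, U u -> U v -> commute u v) ->
    (forall s, S s -> exists k u, [/\ K k, U u & s = k * u]) ->
  forall x y, subgroup_generated S x -> subgroup_generated S y -> K [~ x, y].
Proof.
move=> sK sU nKU cU SKU.
have sKU : is_subgroup [set x | exists k u, [/\ K k, U u & x = k * u]].
  apply/subgroupP; split.
    by exists 1, 1; rewrite mulg1; split=> //; apply: subgroup1.
  move=> _ _ [k [u [Kk Uu ->]]] [l [v [Kl Uv ->]]].
  exists (k * (l^-1 ^ (v * u^-1))), (u * v^-1); split.
  - apply: subgroupM => //; apply/nKU; last exact: subgroupV.
    by apply: subgroupM => //; apply: subgroupV.
  - by apply: subgroupM => //; apply: subgroupV.
  - by rewrite conjgE !invgM !invgK !mulgA mulgVK mulgK.
move=> x y /(gen_sub sKU SKU)[k [u [Kk Uu ->]]] /(gen_sub sKU SKU)[l [v [Kl Uv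
  ->]]].
have -> : [~ k * u, l * v] = k^-1 ^ u * (l^-1 * k) ^ (v * u) * l ^ v.
  rewrite commgEl !conjgE !invgM !mulgA !mulgK -!mulgA;
    congr (_ * (_ * (_ * (_ * (_ * _))))).
  by rewrite !mulgA; congr (_ * _ * _); rewrite -(cU _ _ Uu Uv) mulgK.
have Kl' := subgroupV sK Kl; have Kk' := subgroupV sK Kk.
apply: subgroupM => //; last by apply/nKU.
apply: subgroupM => //; first by apply/nKU.
by apply/nKU; apply: subgroupM.
Qed.

(** An element [x] of [H] permutes the finitely many cosets [h K], so that two
    elements of an infinite set induce the same permutation; then
    [y^-1 * x] is in every conjugate of [K] under [H]. *)
Lemma finite_index_pigeonhole K H X : is_subgroup K -> is_subgroup H ->
    finite_index_in K H -> X `<=` H -> infinite_set X ->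
  exists x y, [/\ X x, X y, x <> y & forall h, H h -> K ((y^-1 * x) ^ h)].
Proof.
move=> sK sH /finite_fsetP[F defF] XH infX.
(* The graph of the permutation of the cosets induced by x. *)
pose act x : {set F * F} :=
  finset (fun c => `[< fsval c.2 = [set x * k | k in fsval c.1] >]).
have [x [y [Xx Xy neq_xy act_xy]]] :
    exists x y, [/\ X x, X y, x <> y & act x = act y].
  apply: contrapT => noxy; apply: infX.
  have act_inj : {in X &, injective act}.
    move=> x y /set_mem Xx /set_mem Xy act_xy; apply: contrapT => neq_xy.
    by apply: noxy; exists x, y.
  rewrite -(eq_finite_set (inj_card_eq act_inj)); exact: finite_finset.
exists x, y; split=> // h Hh.
have coset z : H z -> [set z * k | k in K] \in F.
  by move=> Hz; suff : [set` F] [set z * k | k in K] by []; rewrite -defF;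
    exists z.
pose hK := FSetSub (coset h Hh);
  pose xhK := FSetSub (coset (x * h) (subgroupM sH (XH _ Xx) Hh)).
have mulK z : [set z * k | k in fsval hK] = [set z * h * k | k in K].
  rewrite eqEsubset; split=> w [k]; first by move=> [l Kl <-] <-; exists l;
    rewrite ?mulgA.
  by move=> Kk <-; exists (h * k); rewrite ?mulgA //; exists k.
have : (hK, xhK) \in act x by rewrite inE mulK; apply/asboolP.
rewrite act_xy inE mulK => /asboolP /= /seteqP[xyK _].
have [k Kk def_xh] : [set y * h * k | k in K] (x * h).
  by apply: xyK; exists 1; [apply: subgroup1 | rewrite mulg1].
suff -> : (y^-1 * x) ^ h = k by [].
by rewrite conjgE -!mulgA -def_xh -mulgA !mulKg.
Qed.

End Subgroups.

Local Open Scope ring_scope.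

(** * Transvections and dilations *)

(** The matrix [1 + a E_ij], when [i != j]; for [i = j] the two components need
    not be inverse to each other, in which case the value is [1]. *)
HB.lock Definition transvection (D : unitRingType) (n : nat) (i j : 'I_n)
    (a : D) : GL D n :=
  insubd (1%g : GL D n) (1%:M + a *: delta_mx i j, 1%:M - a *: delta_mx i j).

(** The diagonal matrix with [d] in position [i] and [1] elsewhere, when [d] is
    invertible, and [1] otherwise. *)
HB.lock Definition dilation (D : unitRingType) (n : nat) (i : 'I_n) (d : D) :
    GL D n :=
  insubd (1%g : GL D n)
    (1%:M + (d - 1) *: delta_mx i i, 1%:M + (d^-1 - 1) *: delta_mx i i).

(** Matrices act on the right of row vectors: since rows form a left
    [D]-module, this action is linear even when [D] is not commutative. *)
Section ElementaryMatrices.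
Variables (D : unitRingType) (n : nat).
Implicit Types (g h : GL D n) (i j k l : 'I_n) (a b c d : D) (M : 'M[D]_n).

Local Notation T := transvection.
Local Notation e l := (delta_mx (0 : 'I_1) l : 'rV[D]_n).

Lemma GLmxM g h : GLmx (g * h)%g = GLmx g *m GLmx h. Proof. by []. Qed.

Lemma GLmx1 : GLmx (1%g : GL D n) = 1%:M. Proof. by []. Qed.

Lemma GLmxVK g : GLmx g^-1%g *m GLmx g = 1%:M.
Proof. by rewrite -GLmxM mulVg. Qed.

Lemma GL_rowP g h :
  (forall l, e l *m GLmx g = e l *m GLmx h) -> g = h.
Proof.
by move=> gh; apply/GLmx_inj/row_matrixP => l; rewrite !rowE.
Qed.

Lemma mul_scaled_delta m p q (i : 'I_m) (j k : 'I_p) (l : 'I_q) a b :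
  (a *: delta_mx i j) *m (b *: delta_mx k l) =
    (a * b *+ (j == k)) *: delta_mx i l :> 'M[D]_(m, q).
Proof.
apply/matrixP=> x y; rewrite !mxE (bigD1 j) //= big1 => [|z /negPf zj].
  rewrite !mxE eqxx andbT addr0.
  by case: (x == i); case: (j == k); case: (y == l);
    rewrite ?(mulr1, mulr1n, mulr0n, mulr0, mul0r).
by rewrite !mxE zj andbF mulr0 mul0r.
Qed.

Lemma GLmx_transvection i j a :
  i != j -> GLmx (T i j a) = 1%:M + a *: delta_mx i j.
Proof.
move=> ij; have ji : (j == i) = false by rewrite eq_sym (negPf ij).
rewrite transvection.unlock /GLmx -/(val _) val_insubd /= !mulmxDl !mul1mx
  !mulmxDr !mulmx1.
rewrite -scaleNr !mul_scaled_delta ji !mulr0n !scale0r !addr0 scaleNr.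
by rewrite subrK addrK eqxx.
Qed.

Lemma GLmx_dilation i d : d \is a GRing.unit ->
  GLmx (dilation i d) = 1%:M + (d - 1) *: delta_mx i i.
Proof.
have aux b c : b * c = 1 ->
    (1%:M + (b - 1) *: delta_mx i i) *m (1%:M + (c - 1) *: delta_mx i i) =
    1%:M :> 'M[D]_n.
  move=> bc; rewrite !mulmxDl !mul1mx !mulmxDr !mulmx1.
  rewrite !mul_scaled_delta eqxx mulr1n -addrA -!scalerDl.
  have -> : b - 1 + (b - 1) * (c - 1) = (b - 1) * c by rewrite mulrBr mulr1
    addrC subrK.
  by rewrite mulrBl bc mul1r addrA subrK subrr scale0r addr0.
move=> ud; rewrite dilation.unlock /GLmx -/(val _) val_insubd /=.
by rewrite !aux ?mulVr ?mulrV // !eqxx.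
Qed.

Lemma row_transvection k i j a : i != j ->
  e k *m GLmx (T i j a) = e k + (a *+ (k == i)) *: e j.
Proof.
move=> ij; rewrite GLmx_transvection // mulmxDr mulmx1.
by rewrite -[X in X *m (a *: _)]scale1r mul_scaled_delta mul1r.
Qed.

Lemma row_transvection_id i j a : i != j ->
  e i *m GLmx (T i j a) = e i + a *: e j.
Proof. by move=> ij; rewrite row_transvection // eqxx. Qed.

Lemma row_transvection_neq k i j a : i != j -> k != i ->
  e k *m GLmx (T i j a) = e k.
Proof.
by move=> ij /negPf ki; rewrite row_transvection // ki scale0r addr0.
Qed.

Lemma row_dilation k i d : d \is a GRing.unit ->
  e k *m GLmx (dilation i d) = (if k == i then d else 1) *: e k.
Proof.
move=> ud; rewrite GLmx_dilation // mulmxDr mulmx1.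
rewrite -[X in X *m (_ *: _)]scale1r mul_scaled_delta mul1r.
have [->|_] := eqVneq; last by rewrite mulr0n scale0r addr0 scale1r.
by rewrite mulr1n -[X in X + _]scale1r -scalerDl addrC subrK.
Qed.

Lemma transvectionD i j a b : i != j ->
  T i j (a + b) = (T i j a * T i j b)%g.
Proof.
move=> ij; have ji : j != i by rewrite eq_sym.
apply: GL_rowP => l; rewrite GLmxM mulmxA.
have [->|li] := eqVneq l i; last by rewrite !row_transvection_neq.
rewrite !row_transvection_id // mulmxDl row_transvection_id // -scalemxAl.
by rewrite row_transvection_neq // -addrA -scalerDl (addrC b).
Qed.

Lemma transvection0 i j : i != j -> T i j (0 : D) = 1%g.
Proof.
move=> ij; apply/GLmx_inj.
by rewrite GLmx_transvection // scale0r addr0.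
Qed.

Lemma transvectionN i j a : i != j -> T i j (- a) = (T i j a)^-1%g.
Proof.
move=> ij; apply/esym/mulg1_eq.
by rewrite -transvectionD // subrr transvection0.
Qed.

Lemma transvectionsE : transvections D n =
  [set g | exists i j a, i != j /\ g = T i j a].
Proof.
rewrite eqEsubset; split=> g [i [j [a [ij def_g]]]]; exists i, j, a; split=> //.
  by apply: GLmx_inj; rewrite GLmx_transvection.
by rewrite def_g GLmx_transvection.
Qed.

Lemma SL_subgroup : is_subgroup (SL D n).
Proof. exact: subgroup_gen. Qed.

Lemma transvection_SL i j a : i != j -> SL D n (T i j a).
Proof. by move=> ij; apply: sub_gen; rewrite transvectionsE; exists i, j,
  a. Qed.

Lemma transvection_conj k i j a d : d \is a GRing.unit -> i != j ->
  (T i j a ^ dilation k d)%g =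
    T i j ((if i == k then d^-1 else 1) * a * (if j == k then d else 1)).
Proof.
move=> ud ij; suff eqT : (T i j a * dilation k d)%g =
    (dilation k d * T i j ((if i == k then d^-1 else 1) * a *
                      (if j == k then d else 1))%R)%g.
  by rewrite conjgE eqT mulKg.
apply: GL_rowP => l; rewrite !GLmxM !mulmxA row_dilation // -scalemxAl.
have [->|li] := eqVneq l i; last first.
  by rewrite !row_transvection_neq // row_dilation.
rewrite !row_transvection_id // mulmxDl -scalemxAl !row_dilation //.
rewrite scalerDr !scalerA !mulrA; congr (_ + _ *: _).
by case: (i == k); rewrite ?mulrV ?mul1r.
Qed.

Lemma dilationV k d : d \is a GRing.unit ->
  dilation k d^-1 = (dilation k d)^-1%g.
Proof.
move=> ud; apply/esym/mulg1_eq/GL_rowP => l.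
rewrite GLmxM mulmxA row_dilation // -scalemxAl row_dilation ?unitrV //.
by rewrite scalerA mulmx1; case: ifP => _; rewrite ?mulrV ?mulr1 // scale1r.
Qed.

Lemma dilation_commute i j c d : c \is a GRing.unit -> d \is a GRing.unit ->
  i != j -> commute (dilation i c) (dilation j d).
Proof.
move=> uc ud ij; apply: GL_rowP => l; rewrite !GLmxM !mulmxA !row_dilation //.
rewrite -!scalemxAl !row_dilation // !scalerA.
by have [->|_] := eqVneq l i; rewrite ?mul1r ?mulr1 // (negPf ij) mulr1 mul1r.
Qed.

(** * Transvections generate a perfect group *)

Section DivisionRing.
Hypothesis unitD : forall d, d != 0 -> d \is a GRing.unit.

(** The diagonal matrix of the statement is [w(d) w(-1)], where
    [w(c) = E_ij(c) E_ji(- c^-1) E_ij(c)] exchanges the lines [i] and [j]. *)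
Lemma dilation_pair_SL i j d : i != j -> d != 0 ->
  SL D n (dilation i d * dilation j d^-1)%g.
Proof.
move=> ij d0; have ji : j != i by rewrite eq_sym.
have ud := unitD d0.
pose w c := (T i j c * T j i (- c^-1) * T i j c)%g.
have Sw c : SL D n (w c).
  by do !apply: (subgroupM SL_subgroup); apply: transvection_SL.
have wi c : c \is a GRing.unit -> e i *m GLmx (w c) = c *: e j.
  move=> uc; rewrite !GLmxM !mulmxA row_transvection_id // mulmxDl -scalemxAl.
  rewrite row_transvection_neq // row_transvection_id // scalerDr scalerA.
  rewrite mulrN mulrV // scaleN1r addrCA subrr addr0 -scalemxAl.
  by rewrite row_transvection_neq.
have wj c : c \is a GRing.unit -> e j *m GLmx (w c) = - c^-1 *: e i.
  move=> uc; rewrite !GLmxM !mulmxA row_transvection_neq //.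
  rewrite row_transvection_id // mulmxDl -scalemxAl.
  rewrite row_transvection_neq // row_transvection_id // scalerDr scalerA.
  by rewrite mulNr mulVr // scaleN1r addrCA subrr addr0.
have wl c l : l != i -> l != j -> e l *m GLmx (w c) = e l.
  by move=> li lj; rewrite !GLmxM !mulmxA !row_transvection_neq.
clearbody w.
suff -> : (dilation i d * dilation j d^-1)%g = (w d * w (-1))%g.
  exact: (subgroupM SL_subgroup).
apply: GL_rowP => l; rewrite !GLmxM !mulmxA.
have uN1 : (-1 : D) \is a GRing.unit by rewrite unitrN1.
rewrite row_dilation // -scalemxAl row_dilation ?unitrV //.
have [->|li] := eqVneq l i.
  by rewrite wi // -scalemxAl wj // invrN1 opprK (negPf ij) !scale1r.
have [->|lj] := eqVneq l j; last by rewrite !wl // !scale1r.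
by rewrite wj // -scalemxAl wi // !scalerA mul1r mulrN1 opprK.
Qed.

(** The element [b] itself will do unless it is [0], [1] or [-1]; in these cases
    [b] is central, and any [d] other than [0], [1] and [-1] will do. *)
Lemma exists_commuting_unit b : infinite_set [set: D] ->
  exists d, [/\ d != 0, GRing.comm d b & 1 - d * d != 0].
Proof.
move=> infD.
have sq1 d : d != 1 -> d != -1 -> 1 - d * d != 0.
  move=> d1 dN1; have -> : 1 - d * d = (1 - d) * (1 + d).
    by rewrite mulrDr mulr1 mulrBl mul1r addrA subrK.
  have u1 : 1 - d \is a GRing.unit by apply: unitD; rewrite subr_eq0 eq_sym.
  have u2 : 1 + d \is a GRing.unit by apply: unitD; rewrite addrC addr_eq0.
  by apply: contraTneq u2 => u0; rewrite -(unitrMr _ u1) u0 unitr0.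
have [d [d0 d1 dN1]] : exists d : D, [/\ d != 0, d != 1 & d != -1].
  apply: contrapT => nod; apply: infD.
  apply: (@sub_finite_set _ _ [set` [:: 0; 1; -1 : D]]) => // d _ /=.
  rewrite !inE; apply: contrapT => /negP; rewrite !negb_or => /and3P[? ? ?].
  by apply: nod; exists d.
have [b0|b0] := eqVneq b 0; first by exists d; split=> //; [rewrite b0;
  apply: commr0 | exact: sq1].
have [b1|b1] := eqVneq b 1; first by exists d; split=> //; [rewrite b1;
  apply: commr1 | exact: sq1].
have [bN1|bN1] := eqVneq b (-1); last by exists b; split=> //; exact: sq1.
by exists d; split=> //; [rewrite bN1; apply: commrN1 | exact: sq1].
Qed.

(** With [d] commuting with [b], the commutator of [1 - a E_ij] and the diagonal
    matrix with [d^-1] and [d] in positions [i] and [j] is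
    [1 + (a - d a d) E_ij], and [a - d a d = a (1 - d ^+ 2)]. *)
Lemma transvection_commutator i j b : infinite_set [set: D] -> i != j ->
  exists x y, [/\ SL D n x, SL D n y & T i j b = [~ x, y]%g].
Proof.
move=> infD ij; have [d [d0 db d2]] := exists_commuting_unit b infD.
have ud := unitD d0.
pose a := b * (1 - d * d)^-1.
exists (T i j (- a)), (dilation i d^-1 * dilation j d^-1^-1)%g; split.
- exact: transvection_SL.
- by apply: dilation_pair_SL => //; apply: invr_neq0.
rewrite commgEl conjgM !transvection_conj ?unitrV // ?invrK // -transvectionN
  //.
rewrite opprK eqxx (negPf ij) eq_sym (negPf ij) eqxx.
rewrite mulr1 mul1r -transvectionD //; congr T.
have cda : GRing.comm d a.
  by apply: commrM => //; apply/commrV/commrB; [apply: commr1 | apply: commrM].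
rewrite mulrN mulNr cda -mulrA -[X in X - _]mulr1 -mulrBr mulrVK //.
exact: unitD.
Qed.

(** The matrices supported in the rectangle of the rows in [A] and the columns
    outside [A]: they map into a space on which they vanish, so that all their
    products are zero. *)
Definition rectangular (A : {pred 'I_n}) : set 'M[D]_n :=
  [set M | forall r s, ~~ ((r \in A) && (s \notin A)) -> M r s = 0].

Lemma rectangularM A M M' :
  rectangular A M -> rectangular A M' -> M *m M' = 0.
Proof.
move=> AM AM'; apply/matrixP=> r s; rewrite !mxE big1 // => t _.
have [tA|tA] := boolP (t \in A); first by rewrite AM ?mul0r // tA andbF.
by rewrite AM' ?mulr0 // (negPf tA).
Qed.

(** The factors [1 + M_ij E_ij] multiply to [1 + M]. *)
Lemma rectangular_SL A M : rectangular A M ->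
  exists2 u, SL D n u & GLmx u = 1%:M + M.
Proof.
move=> AM.
suff [] : rectangular A M /\ exists2 u, SL D n u & GLmx u = 1%:M + M by [].
pose P M := rectangular A M /\ exists2 u, SL D n u & GLmx u = 1%:M + M.
have P0 : P 0.
  split=> [r s|]; first by rewrite mxE.
  by exists 1%g; [exact: (subgroup1 SL_subgroup) | rewrite addr0 GLmx1].
have PD M1 M2 : P M1 -> P M2 -> P (M1 + M2).
  move=> [AM1 [u1 Su1 defu1]] [AM2 [u2 Su2 defu2]]; split.
    by move=> r s rs; rewrite mxE AM1 // AM2 // addr0.
  exists (u1 * u2)%g; first exact: (subgroupM SL_subgroup).
  rewrite GLmxM defu1 defu2 mulmxDl mulmxDr mulmx1 mul1mx mulmxDr.
  by rewrite (rectangularM AM1 AM2) mulmx1 addr0 addrA addrAC.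
rewrite -/(P M) [M]matrix_sum_delta.
apply: (big_ind P) => // i _; apply: (big_ind P) => // j _.
have [/andP[iA jA]|ij] := boolP ((i \in A) && (j \notin A)); last first.
  by rewrite AM // scale0r.
have neq_ij : i != j by apply: contraNneq jA => <-.
split.
  move=> r s; apply: contraNeq; rewrite !mxE.
  have [->|_] := eqVneq r i; last by rewrite mulr0 eqxx.
  have [->|_] := eqVneq s j; last by rewrite mulr0 eqxx.
  by rewrite iA.
by exists (T i j (M i j)); [exact: transvection_SL | rewrite GLmx_transvection].
Qed.

(** The abelian group of the matrices [1 + M] with [M] in the rectangle given by
    [A]. For [A] the complement of a single index [p], [M] takes its
    values in the line of the [p]-th basis row and vanishes on it. *)
Definition unipotent (A : {pred 'I_n}) : set (GL D n) :=
  [set u | rectangular A (GLmx u - 1%:M)].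

Lemma unipotentP A u :
  unipotent A u <-> exists2 M, rectangular A M & GLmx u = 1%:M + M.
Proof.
split=> [Au|[M AM defu]]; last by rewrite /unipotent /= defu addrC addKr.
by exists (GLmx u - 1%:M) => //; rewrite addrC subrK.
Qed.

Lemma unipotent_SL A : unipotent A `<=` SL D n.
Proof.
move=> u /unipotentP[M AM defu]; have [v Sv defv] := rectangular_SL AM.
by have -> : u = v by apply: GLmx_inj; rewrite defu.
Qed.

Lemma unipotent_mul A u v : unipotent A u -> unipotent A v ->
  GLmx (u * v)%g = 1%:M + ((GLmx u - 1%:M) + (GLmx v - 1%:M)).
Proof.
move=> /unipotentP[M AM defu] /unipotentP[M' AM' defv].
have addK X : 1%:M + X - 1%:M = X :> 'M[D]_n by rewrite addrC addKr.
rewrite GLmxM defu defv !addK mulmxDl mul1mx mulmxDr mulmx1.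
by rewrite (rectangularM AM AM') addr0 -addrA (addrC M').
Qed.

Lemma unipotent_commute A u v :
  unipotent A u -> unipotent A v -> commute u v.
Proof.
by move=> Au Av; apply: GLmx_inj;
  rewrite !(@unipotent_mul A) // (addrC (_ - _)).
Qed.

Lemma unipotent_subgroup A : is_subgroup (unipotent A).
Proof.
have AM u v : unipotent A u -> unipotent A v -> unipotent A (u * v)%g.
  move=> Au Av; apply/unipotentP; eexists; last exact: unipotent_mul Au Av.
  by move=> r s rs; rewrite mxE Au // Av // addr0.
apply/subgroupP; split=> [r s _|u v Au Av]; first by rewrite GLmx1 subrr mxE.
apply: AM => //; have AN : rectangular A (1%:M - GLmx v).
  by move=> r s rs; rewrite -opprB mxE Av // oppr0.
have [w _ defw] := rectangular_SL AN.
have Aw : unipotent A w by apply/unipotentP; exists (1%:M - GLmx v).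
suff -> : (v^-1)%g = w by [].
apply: mulg1_eq; apply: GLmx_inj; rewrite (unipotent_mul Av Aw) defw GLmx1.
by rewrite (addrC 1%:M (1%:M - GLmx v)) addrK subrKA subrr addr0.
Qed.

(** * The quotient by the special linear group is abelian *)

Lemma transvection_mulE i j a g r s : i != j ->
  GLmx (T i j a * g)%g r s = GLmx g r s + (a *+ (r == i)) * GLmx g j s.
Proof.
move=> ij; have := congr1 (fun v : 'rV_n => (v *m GLmx g) 0 s)
  (row_transvection r a ij).
by rewrite mulmxDl -scalemxAl -mulmxA -!rowE !mxE.
Qed.

Lemma dilation_mulE i d g r s : d \is a GRing.unit ->
  GLmx (dilation i d * g)%g r s = (if r == i then d else 1) * GLmx g r s.
Proof.
move=> ud; have := congr1 (fun v : 'rV_n => (v *m GLmx g) 0 s)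
  (row_dilation r i ud).
by rewrite -scalemxAl -mulmxA -!rowE !mxE.
Qed.

(** Gaussian elimination on columns. *)
Lemma GL_generated (H : set (GL D n)) : is_subgroup H ->
    (forall i j a, i != j -> H (T i j a)) ->
    (forall i d, d != 0 -> H (dilation i d)) ->
  forall g, H g.
Proof.
move=> sH HT Hd.
have HSL : SL D n `<=` H.
  apply: gen_sub => // g; rewrite transvectionsE => -[i [j [a [ij ->]]]];
    exact: HT.
(* The first k columns of g are those of the identity matrix. *)
pose fixes (k : nat) g := forall r s : 'I_n,
  (s < k)%N -> GLmx g r s = (r == s)%:R.
have mulH x g : H x -> H (x * g)%g -> H g.
  by move=> Hx Hxg; rewrite -(mulKg x g); apply: subgroupM => //;
    apply: subgroupV.
suff fixes_H m g : fixes (n - m)%N g -> H g.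
  by move=> g; apply: (fixes_H n) => r s; rewrite subnn.
elim: m g => [|m IH] g.
  rewrite subn0 => g1; have -> : g = 1%g; last exact: subgroup1.
  by apply: GLmx_inj; apply/matrixP=> r s; rewrite g1 // !mxE.
have [nm|mn] := leqP n m.
  by move=> fg; apply: IH; move: nm (leqW nm);
    rewrite -!subn_eq0 => /eqP-> /eqP E; rewrite E in fg.
have kn : (n - m.+1 < n)%N by rewrite ltn_subrL (leq_ltn_trans _ mn).
have Ek : (n - m = (n - m.+1).+1)%N by rewrite subnSK.
move: Ek IH; set k0 := (n - m.+1)%N => -> IH.
pose k : 'I_n := Ordinal kn; rewrite -[k0]/(nat_of_ord k) in IH *.
clearbody k; clear k0 kn.
(* With pivot 1, the column k is cleared by a single rectangular matrix. *)
have pivot1 h : fixes k h -> GLmx h k k = 1 -> H h.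
  move=> fh hkk.
  pose M := \matrix_(r, s) if (r != k) && (s == k) then - GLmx h r k else 0.
  have AM : rectangular [pred r | r != k] M.
    by move=> r s; rewrite mxE !inE negbK; case: ifP.
  have [u Su defu] := rectangular_SL AM.
  apply: (mulH u); first exact: HSL.
  apply: IH => r s; rewrite ltnS => sk.
  have -> : GLmx (u * h)%g r s = GLmx h r s + M r k * GLmx h k s.
    rewrite GLmxM defu mulmxDl mul1mx [LHS]mxE [X in _ + X]mxE; congr (_ + _).
    rewrite (bigD1 k) //= big1 ?addr0 // => t tk.
    by rewrite [M r t]mxE (negPf tk) andbF mul0r.
  rewrite mxE eqxx andbT.
  have [->|sk'] := eqVneq s k.
    have [->|rk] := eqVneq r k; first by rewrite hkk mul0r addr0.
    by rewrite hkk mulr1 subrr.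
  have sltk : (s < k)%N by rewrite ltn_neqAle sk'.
  by rewrite (fh r s) // (fh k s) // (eq_sym k) (negPf sk') mulr0 addr0.
have pivot h : fixes k h -> GLmx h k k != 0 -> H h.
  move=> fh hkk; have u1 := unitD hkk.
  have uV : (GLmx h k k)^-1 \is a GRing.unit by rewrite unitrV.
  apply: (mulH (dilation k (GLmx h k k)^-1)); first by apply: Hd;
    rewrite invr_eq0.
  apply: pivot1 => [r s sk|]; last by rewrite dilation_mulE // eqxx mulVr.
  rewrite dilation_mulE // (fh r s) //; have [->|_] := eqVneq r k;
    last by rewrite mul1r.
  by rewrite -val_eqE /= gtn_eqF // mulr0.
move=> fg; have [gkk|gkk] := eqVneq (GLmx g k k) 0; last exact: pivot.
(* If the entries of column k vanish from row k on, then g maps this column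
   to itself; but g also maps the k-th basis column to it, so both are equal
   and the pivot would be 1. *)
have [p kp gpk] : exists2 p : 'I_n, (k < p)%N & GLmx g p k != 0.
  apply: contrapT => nop.
  have gk0 (r : 'I_n) : (k <= r)%N -> GLmx g r k = 0.
    rewrite leq_eqVlt => /predU1P[/val_inj<- //|kr].
    by apply: contrapT => /eqP grk; apply: nop; exists r.
  have gcol : GLmx g *m col k (GLmx g) = col k (GLmx g).
    apply/colP=> r; rewrite !mxE.
    have [rk|kr] := ltnP r k.
      rewrite (bigD1 r) //= big1 => [|t tr]; rewrite !mxE.
        by rewrite fg // eqxx mul1r addr0.
      have [tk|kt] := ltnP t k; last by rewrite gk0 ?mulr0.
      by rewrite fg // eq_sym (negPf tr) mul0r.
    rewrite gk0 // big1 // => t _; rewrite !mxE.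
    have [tk|kt] := ltnP t k; last by rewrite gk0 ?mulr0.
    by rewrite (fg r t) // -val_eqE /= gtn_eqF ?mul0r // (leq_trans tk).
  have : (GLmx g^-1%g *m (GLmx g *m col k (GLmx g))) k 0 =
         (GLmx g^-1%g *m col k (GLmx g)) k 0 by rewrite gcol.
  rewrite mulmxA GLmxVK mul1mx !colE !mulmxA GLmxVK mul1mx -colE !mxE gkk !eqxx.
  by move/esym/eqP; rewrite oner_eq0.
have kp' : k != p by rewrite neq_ltn kp.
apply: (mulH (T k p 1)); first exact: HT.
apply: pivot => [r s sk|]; last by rewrite transvection_mulE // gkk add0r eqxx
  mul1r.
by rewrite transvection_mulE // !fg // -(val_eqE p) /= gtn_eqF ?mulr0 ?addr0 //
  (ltn_trans sk).
Qed.

Lemma SL_normalised g : normaliser (SL D n) g.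
Proof.
move: g; apply: GL_generated; first exact: subgroup_normaliser.
  move=> i j a ij; apply: (normaliser_sub SL_subgroup).
  exact: transvection_SL.
move=> k d /unitD ud.
have conjT i j a c : i != j -> c \is a GRing.unit ->
    SL D n (T i j a ^ dilation k c)%g.
  by move=> ij uc; rewrite transvection_conj //; apply: transvection_SL.
by apply: normaliser_gen => s;
  rewrite {1}transvectionsE => -[i [j [a [ij ->]]]];
  rewrite -?dilationV //; apply: conjT; rewrite ?unitrV.
Qed.

Lemma exists_neq (n_ge2 : (2 <= n)%N) i : exists j, i != j.
Proof.
case: (eqVneq (val i) 0%N) => i0; last first.
  by exists (Ordinal (ltnW n_ge2)); rewrite -val_eqE.
by exists (Ordinal n_ge2); rewrite -val_eqE /= i0.
Qed.

(** It is enough to consider generators. Two dilations in different positions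
    commute; modulo [SL D n] the position of a dilation is immaterial, by
    [dilation_pair_SL]. *)
Lemma commutator_SL (n_ge2 : (2 <= n)%N) x y : SL D n [~ x, y]%g.
Proof.
have sC z := subgroup_commutes_mod z SL_subgroup SL_normalised.
have cSL z w : SL D n z -> SL D n [~ z, w]%g.
  move=> Sz; rewrite commgEl; apply: (subgroupM SL_subgroup).
    exact: (subgroupV SL_subgroup).
  exact/SL_normalised.
have cC z w : SL D n [~ z, w]%g -> SL D n [~ w, z]%g.
  by move=> Szw; rewrite -invgR; apply: (subgroupV SL_subgroup).
have dd i j c d : i != j -> c != 0 -> d != 0 ->
    SL D n [~ dilation i c, dilation j d]%g.
  move=> ij c0 d0.
  have /commgP/eqP-> := dilation_commute (unitD c0) (unitD d0) ij.
  exact: (subgroup1 SL_subgroup).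
move: x; apply: (@GL_generated [set x | SL D n [~ x,
  y]%g]) => [//|i j a ij|i c c0] /=.
  by apply: cSL; apply: transvection_SL.
apply: cC; move: y.
apply: (@GL_generated [set y | SL D n [~ y,
  dilation i c]%g]) => [//|k j a kj|k d d0] /=.
  by apply: cSL; apply: transvection_SL.
have [->|ki] := eqVneq k i; last exact: dd.
have [j ij] := exists_neq n_ge2 i.
have dV0 : d^-1 != 0 by rewrite invr_eq0.
rewrite -(mulgK (dilation j d^-1) (dilation i d)).
apply: (subgroupM (sC _)); first by apply: cSL; apply: dilation_pair_SL.
by apply: (subgroupV (sC _)); apply: dd; rewrite // eq_sym.
Qed.

Lemma SL_sub_normal (n_ge2 : (2 <= n)%N) N : is_subgroup N -> SL D n `<=` N ->
  is_normal_in N [set: GL D n].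
Proof.
move=> sN SN; split=> // h k _ Nk.
rewrite -(mulKg k^-1%g (k ^ h)%g) invgK -commgEl.
by apply: (subgroupM sN) => //; apply: SN; apply: commutator_SL.
Qed.

(** * Subgroups normalised by the special linear group *)

(** If all the elements of [K] are diagonal, comparing one of them with its
    conjugates under the transvections [1 + a E_pq] shows that its diagonal
    entries are equal and central. *)
Lemma exists_off_diagonal (n_ge2 : (2 <= n)%N) K : SL D n `<=` normaliser K ->
    ~ K `<=` group_center (GL D n) ->
  exists g p q, [/\ K g, p != q & GLmx g p q != 0].
Proof.
move=> nKS ncK; apply: contrapT => nod; apply: ncK => g Kg x.
have rowK h p : K h -> e p *m GLmx h = GLmx h p p *: e p.
  move=> Kh; rewrite -rowE; apply/rowP=> q; rewrite !mxE eqxx.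
  have [->|qp] := eqVneq q p; first by rewrite mulr1.
  rewrite mulr0; apply: contrapT => /eqP hpq; apply: nod.
  by exists h, p, q; rewrite eq_sym.
have gpq p q a : p != q -> a * GLmx g q q = GLmx g p p * a.
  move=> pq; pose h := (g ^ T p q a)%g.
  have Kh : K h by apply/nKS => //; apply: transvection_SL.
  have Th : (T p q a * h)%g = (g * T p q a)%g by rewrite /h conjgE mulVKg.
  have eTh l : e l *m GLmx (T p q a) *m GLmx h = e l *m GLmx g *m GLmx (T p q
    a).
    by rewrite -!mulmxA -!GLmxM Th.
  have qp : q != p by rewrite eq_sym.
  have hq : GLmx h q q = GLmx g q q.
    have /rowP/(_ q) := eTh q; rewrite row_transvection_neq //.
    rewrite !rowK // -scalemxAl row_transvection_neq //.
    by rewrite !mxE !eqxx !mulr1.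
  have /rowP/(_ q) := eTh p; rewrite row_transvection_id // mulmxDl.
  rewrite -scalemxAl !rowK // -scalemxAl row_transvection_id // hq.
  by rewrite !mxE !eqxx (negPf qp) !mulr0 !add0r !mulr1.
have gcomm r s a : a * GLmx g s s = GLmx g r r * a.
  have [<-|rs] := eqVneq r s; last exact: gpq.
  have [q rq] := exists_neq n_ge2 r.
  by rewrite -(gpq _ _ a rq); have := gpq _ _ 1 rq; rewrite mul1r mulr1 => ->.
apply: GL_rowP => r; rewrite !GLmxM !mulmxA rowK // -scalemxAl -rowE.
apply/rowP=> s; rewrite !mxE -(gcomm r s) (bigD1 s) //= big1 => [|t ts].
  by rewrite mxE addr0.
by have /rowP/(_ s) := rowK g t Kg;
  rewrite -rowE !mxE (eq_sym s) (negPf ts) mulr0 => ->; rewrite mulr0.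
Qed.

(** A row [u] off the line of the basis row [p] can be sent to the line of the
    basis row [j] by an element of [SL D n] fixing the basis row [p]. *)
Lemma row_to_line (u : 'rV[D]_n) p q j : p != q -> p != j -> u 0 q != 0 ->
  exists s c, [/\ SL D n s, c != 0, e p *m GLmx s = e p &
                  u *m GLmx s = c *: e j].
Proof.
move=> pq pj uq.
(* If the entry j of u is zero, adding the column q to the column j makes it
   non-zero. *)
wlog uj : u uq / u 0 j != 0 => [wlog_uj|].
  have [uj|] := eqVneq (u 0 j) 0; last exact: wlog_uj.
  have qj : q != j by apply: contraNneq uq => ->; rewrite uj.
  have uT r : (u *m GLmx (T q j 1)) 0 r = u 0 r + u 0 q *+ (r == j).
    rewrite GLmx_transvection // mulmxDr mulmx1 !mxE; congr (_ + _).
    rewrite (bigD1 q) //= big1 => [|t tq]; rewrite !mxE.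
      by rewrite eqxx mul1r addr0; case: (r == j); rewrite ?mulr1 ?mulr0.
    by rewrite (negPf tq) mul1r mulr0.
  have [||s [c [Ss c0 ps us]]] := wlog_uj (u *m GLmx (T q j (1 : D))).
  - by rewrite uT (negPf qj) addr0.
  - by rewrite uT uj add0r eqxx.
  exists (T q j 1 * s)%g, c; split=> //.
  - by apply: (subgroupM SL_subgroup) => //; apply: transvection_SL.
  - by rewrite GLmxM mulmxA row_transvection_neq.
  - by rewrite GLmxM mulmxA.
(* The row j of M is proportional to u, and kills its entries other than j. *)
pose M := \matrix_(r, s) if (r == j) && (s != j) then - (u 0 j)^-1 * u 0 s else
  0.
have AM : rectangular (pred1 j) M.
  by move=> r s; rewrite !inE mxE; case: ifP.
have [s Ss defs] := rectangular_SL AM.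
exists s, (u 0 j); split=> //.
  rewrite defs mulmxDr mulmx1 -rowE [row p M](_ : _ = 0) ?addr0 //.
  by apply/rowP=> r; rewrite !mxE (negPf pj).
apply/rowP=> r; rewrite defs mulmxDr mulmx1 !mxE (bigD1 j) //= big1 => [|t tj].
  rewrite !mxE !eqxx addr0 /=; have [->|rj] := eqVneq r j.
    by rewrite /= mulr0 mulr1 addr0.
  by rewrite /= mulrA mulrN mulrV ?unitD // mulN1r subrr mulr0.
by rewrite !mxE (negPf tj) mulr0.
Qed.

(** This replaces the transitivity of [K] on all lines in the argument of
    Iwasawa: coordinate lines are enough to reach the elementary
    transvections. *)
Lemma moves_to_all_lines (n_ge2 : (2 <= n)%N) K : is_subgroup K -> SL D n `<=`
  normaliser K ->
    ~ K `<=` group_center (GL D n) ->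
  exists p, forall j, exists h c, [/\ K h, c != 0 & e p *m GLmx h = c *: e j].
Proof.
move=> sK nKS ncK; have [g [p [q [Kg pq gpq]]]] := exists_off_diagonal n_ge2
  nKS ncK.
exists p => j; have [->|jp] := eqVneq j p.
  exists 1%g, 1; split; [exact: subgroup1 | exact: oner_neq0 |].
  by rewrite GLmx1 mulmx1 scale1r.
have gq : (e p *m GLmx g) 0 q != 0 by rewrite -rowE mxE.
have [|s [c [Ss c0 ps gs]]] := row_to_line pq _ gq (j := j).
  by rewrite eq_sym.
exists (g ^ s)%g, c; split=> //; first by apply/nKS.
have psV : e p *m GLmx s^-1%g = e p.
  by rewrite -{1}ps -mulmxA -GLmxM mulgV GLmx1 mulmx1.
by rewrite conjgE !GLmxM !mulmxA psV.
Qed.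

Lemma SL_sub_normalised (n_ge2 : (2 <= n)%N) K : infinite_set [set: D] ->
  is_subgroup K ->
    SL D n `<=` normaliser K -> ~ K `<=` group_center (GL D n) ->
  SL D n `<=` K.
Proof.
move=> infD sK nKS ncK.
have [p movesp] := moves_to_all_lines n_ge2 sK nKS ncK.
pose A := [pred r | r != p].
have KU t : transvections D n t -> exists h u, [/\ K h,
  unipotent A u & t = (h * u)%g].
  rewrite transvectionsE => -[i [j [a [ij ->]]]].
  have [k [c [Kk c0 kj]]] := movesp j.
  (* T i j a - 1 takes its values in the line of j, which k^-1 sends to the
     line of p, and vanishes on the line of j = p k. *)
  pose u := (T i j a ^ k^-1)%g.
  have Au : unipotent A u.
    apply/unipotentP.
    exists (GLmx k *m (a *: delta_mx i j) *m GLmx k^-1%g); last first.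
      rewrite /u conjgE invgK !GLmxM GLmx_transvection // mulmxA mulmxDr mulmx1.
      by rewrite mulmxDl -GLmxM mulgV.
    have eVk : e j *m GLmx k^-1%g = c^-1 *: e p.
      have -> : e j = c^-1 *: (e p *m GLmx k).
        by rewrite kj scalerA mulVr ?unitD // scale1r.
      by rewrite -scalemxAl -mulmxA -GLmxM mulgV GLmx1 mulmx1.
    have -> : a *: delta_mx i j = a *: delta_mx i (0 : 'I_1) *m e j.
      by rewrite -scalemxAl mul_delta_mx.
    move=> r s; rewrite mulmxA -mulmxA eVk mxE big_ord1 !inE.
    have [->|rp] := eqVneq r p; last first.
      rewrite negbK => sp; rewrite [X in _ * X]mxE [X in _ * (_ * X)]mxE.
      by rewrite (negPf sp) ?andbF ?mulr0n !mulr0.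
    have -> : (GLmx k *m (a *: delta_mx i (0 : 'I_1))) p 0 = 0;
      last by rewrite mul0r.
    have : e p *m (GLmx k *m (a *: delta_mx i (0 : 'I_1))) = 0.
      rewrite mulmxA kj mul_scaled_delta eq_sym (negPf ij).
      by rewrite mulr0n scale0r.
    by rewrite -rowE => /rowP/(_ 0); rewrite [LHS]mxE [RHS]mxE.
  exists (k^-1 * k ^ u^-1)%g, u; split=> //.
    apply: (subgroupM sK); first exact: (subgroupV sK).
    apply/nKS => //; apply: (subgroupV SL_subgroup); exact: unipotent_SL Au.
  have -> : T i j a = (u ^ k)%g by rewrite /u conjgKV.
  by clearbody u; rewrite !conjgE invgK !mulgA mulgVK.
have KC := commutator_in_complement sK (unipotent_subgroup A)
  (subset_trans (@unipotent_SL A) nKS) (@unipotent_commute A) KU.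
apply: gen_sub => // t; rewrite transvectionsE => -[i [j [a [ij ->]]]].
have [x [y [Sx Sy ->]]] := transvection_commutator a infD ij.
exact: KC.
Qed.

Lemma transvection_noncentral i j a : i != j -> a != 0 ->
  ~ group_center (GL D n) (T i j a).
Proof.
move=> ij a0 /(_ (T j i 1)) /(congr1 (fun g => GLmx g i i)).
have ji : j != i by rewrite eq_sym.
rewrite /= !transvection_mulE // !GLmx_transvection // !mxE !eqxx.
rewrite (negPf ij) (negPf ji) /= !(mulr0, mulr1, addr0, mulr0n, mul0r, add0r).
move/eqP; rewrite -subr_eq0 addrAC subrr add0r; exact/negP.
Qed.

(** * Almost subnormal subgroups *)

Lemma finite_index_SL (n_ge2 : (2 <= n)%N) H K : infinite_set [set: D] ->
    is_subgroup K -> is_subgroup H -> K `<=` H -> finite_index_in K H ->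
  SL D n `<=` H -> SL D n `<=` K.
Proof.
move=> infD sK sH KH finK HSL.
pose i : 'I_n := Ordinal (ltnW n_ge2); have [j ij] := exists_neq n_ge2 i.
(* The largest subgroup of K normalised by H. *)
pose L := [set x | forall h, H h -> K (x ^ h)%g].
have sL : is_subgroup L.
  apply/subgroupP; split=> [h _|x y Lx Ly h Hh].
    by rewrite conj1g; exact: subgroup1.
  rewrite conjMg conjVg; apply: (subgroupM sK); first exact: Lx.
  by apply: (subgroupV sK); apply: Ly.
have nLH : H `<=` normaliser L.
  move=> g Hg x; split=> Lx h Hh.
    have -> : (x ^ h)%g = ((x ^ g) ^ (g^-1 * h))%g by rewrite -conjgM mulVKg.
    by apply: Lx; apply: (subgroupM sH) => //; apply: (subgroupV sH).
  by rewrite -conjgM; apply: Lx; apply: (subgroupM sH).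
pose X : set (GL D n) := range (T i j).
have XH : X `<=` H by move=> _ [a _ <-]; apply: HSL; apply: transvection_SL.
have infX : infinite_set X.
  move=> finX; apply: infD; move: finX;
    rewrite /X (eq_finite_set (inj_card_eq _)) //.
  move=> a b _ _ eqT; apply/eqP; rewrite -subr_eq0; apply: contrapT => ab0.
  apply: (@transvection_noncentral i j (a - b)) => //; first exact/negP.
  by rewrite transvectionD // transvectionN // eqT mulgV => x;
    exact/commute_sym/commute1.
have [_ [_ [[a _ <-] [b _ <-] neq Lab]]] :=
  finite_index_pigeonhole sK sH finK XH infX.
have SL_L : SL D n `<=` L.
  apply: SL_sub_normalised => //; first exact: subset_trans nLH.
  move=> /(_ _ Lab); rewrite -transvectionN // -transvectionD //.
  apply: transvection_noncentral => //; rewrite addrC subr_eq0.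
  by apply: contra_notN neq => /eqP->.
move=> x /SL_L Lx; rewrite -(conjg1 x); apply: Lx; exact: (subgroup1 sH).
Qed.

Lemma almost_subnormal_SL (n_ge2 : (2 <= n)%N) N : infinite_set [set: D] ->
    almost_subnormal N -> ~ N `<=` group_center (GL D n) ->
  SL D n `<=` N.
Proof.
move=> infD [r [C [C0 Cr sC stepC]]] ncN.
suff SLC (i : nat) : (i <= r)%N -> SL D n `<=` C i by rewrite -Cr; apply: SLC.
(* Going up the chain from N shows that no term is central. *)
have NC m : (m <= r)%N -> N `<=` C (r - m)%N.
  elim: m => [_|m IH mr]; first by rewrite subn0 Cr.
  apply: subset_trans (IH (ltnW mr)) _; rewrite -subnSK //.
  by have [] := stepC (r - m.+1)%N; rewrite ?ltn_subrL // (leq_ltn_trans _ mr).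
elim: i => [_|i IH ir]; first by rewrite C0.
have SLi := IH (ltnW ir); have [CC nf] := stepC i ir.
have sK := sC _ ir; have sH := sC _ (ltnW ir).
case: nf => [nC|fC]; last exact: finite_index_SL fC SLi.
apply: SL_sub_normalised => //.
  exact: subset_trans SLi (normal_normaliser sH nC).
by apply: contra_not ncN; apply: subset_trans; rewrite -(subKn ir); apply: NC;
  rewrite leq_subr.
Qed.

Lemma normal_almost_subnormal (G : groupType) (N : set G) :
  is_subgroup N -> is_normal_in N [set: G] -> almost_subnormal N.
Proof.
move=> sN nN; exists 1%N, (fun i : nat => if i is 0%N then [set: G] else N).
split=> // [i _|i]; first by case: i => [|i] //; apply/subgroupP; split.
rewrite ltnS leqn0 => /eqP->; by split=> //; left.
Qed.

Lemma SL_sub_noncentral (n_ge2 : (2 <= n)%N) (N : set (GL D n)) :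
  SL D n `<=` N -> ~ N `<=` group_center (GL D n).
Proof.
move=> SN NZ; have [j ij] := exists_neq n_ge2 (Ordinal (ltnW n_ge2)).
apply: (transvection_noncentral ij (oner_neq0 D)); apply: NZ; apply: SN.
exact: transvection_SL.
Qed.

Lemma Delta_verticesP (n_ge2 : (2 <= n)%N) (N : set (GL D n)) :
    infinite_set [set: D] ->
  vertices (Delta_graph (GL D n)) N <->
  [/\ is_subgroup N, N <> [set: GL D n] & SL D n `<=` N].
Proof.
move=> infD; split=> [[[sN _ NT] [ncN asN]]|[sN NT SN]].
  by split=> //; exact: almost_subnormal_SL.
have ncN := SL_sub_noncentral n_ge2 SN.
split; split=> //; last first.
  by apply: normal_almost_subnormal => //; exact: SL_sub_normal.
by move=> N1; apply: ncN; rewrite N1 => _ -> x; exact/commute_sym/commute1.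
Qed.

End DivisionRing.

End ElementaryMatrices.

Theorem theorem2p9 (D : unitRingType)
    (D_division : forall x : D, x != 0 -> x \is a GRing.unit)
    (D_infinite : infinite_set [set: D])
    (n : nat) (n_ge2 : (2 <= n)%N) :
  [/\ complete_graph (Delta_graph (GL D n)),
      vertices (Delta_graph (GL D n)) =
        [set N | [/\ is_subgroup N, N <> [set: GL D n],
                     ~ (N `<=` group_center (GL D n)) &
                     is_normal_in N [set: GL D n]]] &
      forall N : set (GL D n), is_subgroup N -> N <> [set: GL D n] ->
        (vertices (Delta_graph (GL D n)) N <-> SL D n `<=` N)].
Proof.
have vertP N := Delta_verticesP D_division n_ge2 N D_infinite.
split.
- move=> A B VA VB AB.
  have [[pA SA] [pB SB]] := (VA, VB); split=> //; split=> //.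
  move=> AB1; have [_ _ SLA] := (vertP A).1 VA;
    have [_ _ SLB] := (vertP B).1 VB.
  have SLAB : SL D n `<=` A `&` B by move=> g Sg; split; [apply: SLA |
    apply: SLB].
  apply: (SL_sub_noncentral n_ge2 SLAB).
  by rewrite AB1 => _ -> x; exact/commute_sym/commute1.
- rewrite eqEsubset; split=> N.
    move=> /vertP[sN NT SN]; split=> //; first exact: SL_sub_noncentral.
    exact: SL_sub_normal.
  move=> [sN NT ncN nN]; apply/vertP; split=> //.
  by apply: almost_subnormal_SL => //; apply: normal_almost_subnormal.
- move=> N sN NT; split=> [/vertP[]//|SN].
  by apply/vertP.
Qed.
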